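(* Let $t\ge 1$ be an integer and let $G$ be a graph on $n$ vertices with independence number $\alpha(G)\leq t$. Then $$(2t-1)\,{\rm b}^{\ast}(G)\leq (t-1)n+t\chi(G).$$
   Context: All graphs are finite, undirected, without loops or multiple edges, with at least one vertex. $\chi(G)$ is the chromatic number and $\alpha(G)$ the maximum size of an independent set of $G$. Let $c$ be a proper vertex coloring of $G$ using $k$ colors (every one of the $k$ colors is used). A vertex $u$ is a b-vertex (of $c$) if for each color $j\neq c(u)$, $u$ has a neighbor of color $j$. A vertex $u$ is a nice vertex (of $c$) if for each color $j\neq c(u)$, $u$ has a neighbor of color $j$ which is itself a b-vertex. The coloring $c$ is a ${\rm b}^{\ast}$-coloring if it has at least one nice vertex. The ${\rm b}^{\ast}$-chromatic number ${\rm b}^{\ast}(G)$ is the maximum number of colors used in a ${\rm b}^{\ast}$-coloring of $G$. *)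

(* Defs.v *)
From mathcomp Require Import all_boot.

Set Implicit Arguments.
Unset Strict Implicit.
Unset Printing Implicit Defensive.

(* Finite simple graphs; nonemptiness of the vertex set is not built in. *)
Record sgraph := SGraph {
  vertex :> finType;
  edge : rel vertex;
  edge_sym : symmetric edge;
  edge_irr : irreflexive edge }.

Section Graph.
Variable G : sgraph.

Definition independent (S : {set G}) : bool :=
  [forall u in S, forall v in S, ~~ edge u v].

Definition independence_number : nat :=
  \max_(S : {set G} | independent S) #|S|.

Section Coloring.
Variables (k : nat) (c : {ffun G -> 'I_k}).

Definition proper_coloring : bool :=
  [forall u, forall v, edge u v ==> (c u != c v)].

Definition uses_all_colors : bool :=
  [forall j : 'I_k, exists u, c u == j].

Definition b_vertex (u : G) : bool :=
  [forall j : 'I_k, (j != c u) ==> [exists v, edge u v && (c v == j)]].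

Definition nice_vertex (u : G) : bool :=
  [forall j : 'I_k,
     (j != c u) ==> [exists v, [&& edge u v, c v == j & b_vertex v]]].

Definition bstar_coloring : bool :=
  [&& proper_coloring, uses_all_colors & [exists u, nice_vertex u]].

End Coloring.

(* Unused colors are allowed here, so this is colorability with at most k
   colors; the least such k is the same either way. *)
Definition colorable (k : nat) : bool :=
  [exists c : {ffun G -> 'I_k}, proper_coloring c].

Lemma colorable_exists : exists k, colorable k.
Proof.
exists #|G|; apply/existsP; exists [ffun u => enum_rank u].
apply/forallP => u; apply/forallP => v; apply/implyP => uv.
rewrite !ffunE (inj_eq enum_rank_inj); apply/eqP => E.
by move: uv; rewrite E edge_irr.
Qed.

Definition chromatic_number : nat := ex_minn colorable_exists.

(* Since every color is used, k <= #|G| loses no b*-coloring. *)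
Definition bstar_number : nat :=
  \max_(k < #|G|.+1 | [exists c : {ffun G -> 'I_k}, bstar_coloring c]) k.

End Graph.

(* Main.v *)
(** Let [c] be a b*-coloring with [k] colors and [s] singleton classes, so that
    [2k - s <= n].  Niceness gives a system [w] of b-vertices, one per color;
    the vertex of a singleton class is the only possible neighbor of its color,
    hence it is adjacent to every other [w j].  In an optimal coloring of [G] a
    class contains at most [t] of the [w j], and exactly one if that one forms a
    singleton class of [c]; therefore [k + (t - 1) s <= t * chi].  Combining the
    two inequalities eliminates [s]. *)
Require Import Defs.
From mathcomp Require Import all_boot.
From mathcomp Require Import zify.

Set Implicit Arguments.
Unset Strict Implicit.
Unset Printing Implicit Defensive.

Section BStar.
Variable G : sgraph.

Lemma proper_coloringP k (c : {ffun G -> 'I_k}) :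
  reflect (forall u v, edge u v -> c u != c v) (proper_coloring c).
Proof.
apply: (iffP 'forall_forallP) => H u v; first exact/implyP/H.
exact/implyP/H.
Qed.

Lemma card_independent (S : {set G}) :
  independent S -> #|S| <= independence_number G.
Proof. exact: (@leq_bigmax_cond _ (@independent G) (fun S => #|S|)). Qed.

Lemma chromatic_colorable : colorable G (chromatic_number G).
Proof. by rewrite /chromatic_number; case: ex_minnP. Qed.

Section Coloring.
Variables (k : nat) (c : {ffun G -> 'I_k}).

Definition singleton_colors : {set 'I_k} :=
  [set j | #|[set v | c v == j]| == 1].

Lemma singleton_color_inj u v :
  c u \in singleton_colors -> c v = c u -> v = u.
Proof.
rewrite inE => /cards1P[x cx] cvu.
have: u \in [set v0 | c v0 == c u] by rewrite inE.
have: v \in [set v0 | c v0 == c u] by rewrite inE cvu.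
by rewrite cx !inE => /eqP-> /eqP->.
Qed.

(** Classes are nonempty, so each has two vertices unless it is a singleton, whose missing unit the
    second summand supplies; sum over the colors. *)
Lemma colors_le_card_singleton :
  uses_all_colors c -> 2 * k <= #|G| + #|singleton_colors|.
Proof.
move=> /forallP c_onto.
have -> : 2 * k = \sum_(j < k) 2 by rewrite sum_nat_const card_ord mulnC.
have -> : #|G| = \sum_(j < k) #|[set v | c v == j]|.
  rewrite -sum1_card (partition_big c predT) //=.
  by apply: eq_bigr => j _; rewrite -sum1dep_card.
have -> : #|singleton_colors| = \sum_(j < k) (j \in singleton_colors).
  by rewrite -sum1_card big_mkcond; apply: eq_bigr => j _; case: (j \in _).
rewrite -big_split leq_sum // => j _ /=.
have [v cvj] := existsP (c_onto j).
have : 0 < #|[set v | c v == j]| by apply/card_gt0P; exists v; rewrite inE.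
by rewrite inE; case: #|_| => [|[|m]].
Qed.

Lemma bstar_b_system :
  bstar_coloring c ->
  exists w : 'I_k -> G, forall j, c (w j) = j /\ b_vertex c (w j).
Proof.
case/and3P=> _ _ /existsP[u /forallP nice_u].
apply: (fin_all_exists (P := fun j v => c v = j /\ b_vertex c v)) => j.
have [->|j_cu] := eqVneq j (c u).
  (* For its own color [u] serves itself: a nice vertex is in particular a b-vertex. *)
  exists u; split=> //; apply/forallP => i; apply/implyP => i_cu.
  have /existsP[v /and3P[uv cv _]] := implyP (nice_u i) i_cu.
  by apply/existsP; exists v; rewrite uv.
by have /existsP[v /and3P[_ /eqP cv bv]] := implyP (nice_u j) j_cu; exists v.
Qed.

Section BSystem.
Variable w : 'I_k -> G.
Hypothesis w_b : forall j, c (w j) = j /\ b_vertex c (w j).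

(** The b-vertex [w i] has a neighbor of color [j], and [w j] is the only candidate. *)
Lemma edge_singleton_color i j :
  j \in singleton_colors -> i != j -> edge (w i) (w j).
Proof.
move=> jS ij; have [ci /forallP/(_ j)] := w_b i; have [cj _] := w_b j.
rewrite ci eq_sym ij => /existsP[v /andP[wiv /eqP cvj]].
by rewrite -(@singleton_color_inj (w j) v) ?cj.
Qed.

Lemma colors_singleton_le m t :
  0 < t -> independence_number G <= t -> colorable G m ->
  k + (t - 1) * #|singleton_colors| <= t * m.
Proof.
move=> t_gt0 alpha_t /existsP[d /proper_coloringP d_proper].
have w_inj : injective w by apply: (can_inj (g := c)) => j; case: (w_b j).
pose F a := [set j | d (w j) == a].
(* The representatives [w j] with [j] in [F a] share a color of [d], so they are independent. *)
have F_t a : #|F a| <= t.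
  rewrite -(card_imset _ w_inj); apply: leq_trans alpha_t.
  apply: card_independent; apply/forall_inP => _ /imsetP[i + ->].
  rewrite inE => /eqP di; apply/forall_inP => _ /imsetP[j + ->].
  by rewrite inE => /eqP dj; apply/negP => /d_proper; rewrite di dj eqxx.
have F_S a j : j \in F a -> j \in singleton_colors -> F a = [set j].
  rewrite inE => /eqP dj jS; apply/setP => i; rewrite !inE.
  have [->|ij] := eqVneq i j; first by rewrite dj eqxx.
  by rewrite -dj; apply/negbTE/d_proper/edge_singleton_color.
have k_sum : k = \sum_(a < m) #|F a|.
  rewrite -[LHS]card_ord -sum1_card (partition_big (d \o w) predT) //=.
  by apply: eq_bigr => a _; rewrite -sum1dep_card.
have -> : #|singleton_colors| = \sum_(a < m) #|singleton_colors :&: F a|.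
  rewrite -sum1_card (partition_big (d \o w) predT) //=.
  apply: eq_bigr => a _; rewrite -sum1_card.
  by apply: eq_bigl => j; rewrite !inE.
have -> : t * m = \sum_(a < m) t by rewrite sum_nat_const card_ord mulnC.
rewrite [X in X + _]k_sum big_distrr -big_split leq_sum // => a _ /=.
(* If [F a] misses [singleton_colors], use [F_t]; otherwise both cardinals are 1, and
   [1 + (t - 1) = t] as [0 < t]. *)
have [->|[j]] := set_0Vmem (singleton_colors :&: F a).
  by rewrite cards0 muln0 addn0.
rewrite inE => /andP[jS jF]; rewrite (F_S _ _ jF jS).
by rewrite (setIidPr _) ?sub1set // cards1 muln1 subnKC.
Qed.

End BSystem.

End Coloring.

End BStar.

Theorem theorem1 (t : nat) (G : sgraph) (ht : 1 <= t) (hG : 0 < #|G|)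
    (halpha : independence_number G <= t) :
  (2 * t - 1) * bstar_number G <= (t - 1) * #|G| + t * chromatic_number G.
Proof.
rewrite /bstar_number; elim/big_ind: _ => [|x y le_x le_y|k].
- by rewrite muln0.
- by rewrite maxnMr geq_max le_x.
case/existsP=> c c_bstar; have [w w_b] := bstar_b_system c_bstar.
have [_ c_onto _] := and3P c_bstar.
have := colors_le_card_singleton c_onto.
have := colors_singleton_le w_b ht halpha (chromatic_colorable G).
(* Add [t - 1] times the bound on [2 * k] to the other one: the terms in [#|singleton_colors c|]
   cancel, and [2 * (t - 1) + 1 = 2 * t - 1]. *)
by nia.
Qed.
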